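(* Fix a class $\mathcal{C}$ of cooperative multi-agent systems whose observable semantics are defined by asynchronous activations and event passing. Let $\mathbb{T}$ be the space of observable execution traces, let $\mathbb{G}$ be the space of time-indexed labeled Dynamic Interaction Graph (DIG) sequences $\{G(t)\}_{t\in\mathbb{Z}}$, and let $\Psi:\mathbb{T}\to\mathbb{G}$ be the DIG construction operator. Let $\mathcal{F}$ be a set and let $\Phi:\mathbb{T}\to\mathcal{F}$ be any system-level functional that depends only on observable interactions, equivalently, is invariant over traces with isomorphic DIGs: for all $\mathcal{T}_1,\mathcal{T}_2\in\mathbb{T}$, $\Psi(\mathcal{T}_1)\cong\Psi(\mathcal{T}_2)$ implies $\Phi(\mathcal{T}_1)=\Phi(\mathcal{T}_2)$. Then there exists a graph functional $\mathcal{I}:\mathbb{G}\to\mathcal{F}$ such that, for every trace $\mathcal{T}\in\mathbb{T}$, $$\Phi(\mathcal{T})=\mathcal{I}(\Psi(\mathcal{T})).$$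
   Context: **Systems.** A cooperative multi-agent system is a tuple $\mathcal{S}=(\mathcal{A},\mathcal{E},\mathcal{P},\mathbb{Z})$, where $\mathcal{A}=\{a_1,\dots,a_N\}$ is a finite set of agents, $\mathcal{E}$ is the set of interaction events, $\mathcal{P}$ is a problem instance, and $\mathbb{Z}$ is the discrete logical time domain. The problem $\mathcal{P}$ is encoded as an initial event $e_0\in\mathcal{E}$ delivered at $t=0$ to an initial subset $\mathcal{A}_0\subseteq\mathcal{A}$; execution terminates when a terminal event $e_\infty$ is generated. Logical time advances whenever an interaction (agent activation or event delivery) occurs. Each agent $a$ is a non-deterministic transformation $f_a:I_a\to O_a$ with $I_a,O_a\subseteq\mathcal{E}$, and maintains an event buffer $B_a(t)\subseteq\mathcal{E}$. An agent not activated at time $t-1$ is activated at time $t$ if $B_a(t)\neq B_a(t-1)$. An event is a pair $e=(p_e,\pi_e)$ of a payload $p_e$ and a delivery policy $\pi_e$; at time $t$ the policy determines a recipient set $R_t(e)\subseteq\mathcal{A}$ and is updated to a new policy $\pi_e'$, and $e$ is appended to the buffers of agents in $R_t(e)$; if $\pi_e'$ is empty, the event expires. **Traces.** An execution trace is a record $\mathcal{T}=\{(a_t,e_t,t)\}_{t\in\mathbb{Z}}$, where $a_t$ is the agent activated at time $t$ (if any) and $e_t$ is the event generated or delivered at that time. $\mathcal{F}$ is thought of as a space of failure signals and explanations. **DIG.** The construction operator $\Psi$ sends a trace $\mathcal{T}$ to its Dynamic Interaction Graph sequence $\{G(t)\}_{t\in\mathbb{Z}}$, where $$G(t)=\bigl(\mathcal{V}_A(t)\cup\mathcal{V}_E(t),\,\mathcal{E}_G(t),\,\phi_t\bigr)$$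 is a labeled directed bipartite graph, as follows. - $\mathcal{V}_A(t)$ is the set of activation nodes. Each is $v=(\mathrm{id}_v,a_v,\tau_v)$ and represents one activation of agent $a_v\in\mathcal{A}$ over the interval $\tau_v=[t_v^{\mathrm{start}},t_v^{\mathrm{end}}]$. - $\mathcal{V}_E(t)$ is the set of event nodes. Each is $e_G=(e,\tau_e)$ with $\tau_e=\bigl(t_e^{\mathrm{gen}},\{t_e^{\mathrm{recv}}(b)\}_{b\in R_\infty(e)}\bigr)$, i.e. an event together with its generation time and realized delivery times to its recipients. - $\mathcal{E}_G(t)$ is the set of directed edges, which only connect activation nodes and event nodes: a generation edge $v\to e_G$ when activation $v$ generates event $e$, and a delivery edge $e_G\to v_b$ when event $e$ triggers activation $v_b$. - $\phi_t:\mathcal{E}_G(t)\to\{\textsc{consume},\textsc{delay},\textsc{reroute},\textsc{discard}\}$ is an edge labeling recording how each interaction edge was treated by the agent's activation: consumed (acted on and removed from the buffer), delayed (kept in the buffer), rerouted (forwarded to another activation), or discarded (dropped). **Isomorphism.** The symbol $\cong$ denotes isomorphism of time-indexed labeled DIGs, i.e. graph isomorphism that preserves bipartite node types, directed edges, and edge labels. *)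

(* Defs.v *)
From HB Require Import structures.
From mathcomp Require Import all_boot all_order all_algebra.
From mathcomp Require Import boolp classical_sets functions cardinality.

Set Implicit Arguments.
Unset Strict Implicit.
Unset Printing Implicit Defensive.

Import Order.TTheory GRing.Theory Num.Theory.
Local Open Scope classical_set_scope.
Local Open Scope ring_scope.

(* Logical time is [int].  [Agent], [Payload] and [Policy] are
   ambient sets of names: every system has its own finite set of agents and its
   own set of events inside them. *)

Inductive label := Consume | Delay | Reroute | Discard.

HB.instance Definition _ := gen_eqMixin label.
HB.instance Definition _ := gen_choiceMixin label.

Section Definitions.
Context (Agent Payload Policy : Type).

Definition event : Type := (Payload * Policy)%type.

(* [transform a x] is the set of possible outputs of the non-deterministic
   map f_a on x.  The problem instance is the pair
   ([init_event], [init_agents]). *)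
Record system := System {
  agents : set Agent;
  events : set event;
  init_event : event;
  init_agents : set Agent;
  terminal : set event;
  inputs : Agent -> set event;
  outputs : Agent -> set event;
  transform : Agent -> event -> set event;
  recipients : Policy -> int -> set Agent;
  update : Policy -> int -> Policy;
  empty_policy : set Policy;
  agents_finite : finite_set agents;
  init_event_in : events init_event;
  init_agents_sub : init_agents `<=` agents;
  init_agentsE : init_agents = recipients init_event.2 0;
  terminal_sub : terminal `<=` events;
  inputs_sub : forall a, agents a -> inputs a `<=` events;
  outputs_sub : forall a, agents a -> outputs a `<=` events;
  transform_sub : forall a x,
    agents a -> inputs a x -> transform a x `<=` outputs a;
  recipients_sub : forall p t, recipients p t `<=` agents
}.

(* An event as generated, with its generation time.  At most one event is
   generated at each time, so this tells apart repeated generations of equal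
   events. *)
Definition occurrence : Type := (event * int)%type.

(* The component e_t of a trace; the set is that of the agents to whose buffers
   the event is appended.  [Initial] is the delivery of the problem: the initial
   event has no generating agent.  The label of [Generated] is the one carried
   by the generation edge. *)
Inductive interaction :=
| Initial of event & set Agent
| Generated of Agent & event & label
| Delivered of occurrence & set Agent.

(* [obs_active] is the component a_t: a set, as one delivery may reach, hence
   activate, several agents.  An activation spanning an interval is observed at
   each time of this interval.  [obs_treat a o] is what [a] does at that time
   with the buffered [o], the source of the edge labels. *)
Record observation := Observation {
  obs_active : set Agent;
  obs_event : option interaction;
  obs_treat : Agent -> occurrence -> option label
}.

Definition trace := int -> observation.

Definition quiet (w : observation) : Prop :=
  [/\ obs_active w = set0, obs_event w = None
    & forall a o, obs_treat w a o = None].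

Definition emitted (tr : trace) (o : occurrence) : Prop :=
  match obs_event (tr o.2) with
  | Some (Initial e _) => o.1 = e
  | Some (Generated _ e _) => o.1 = e
  | _ => False
  end.

Definition delivered (tr : trace) (o : occurrence) (b : Agent) (t : int) : Prop :=
  match obs_event (tr t) with
  | Some (Initial e R) => o = (e, t) /\ R b
  | Some (Delivered o' R) => o = o' /\ R b
  | _ => False
  end.

(* An activation of [a] is a maximal run of times at which [a] is activated;
   its end is [None] if it never ends. *)
Definition within (s : int) (u : option int) (t : int) : Prop :=
  s <= t /\ (if u is Some n then (t <= n : Prop) else True).

Definition activation (tr : trace) (a : Agent) (s : int) (u : option int) : Prop :=
  [/\ within s u s,
      forall t, within s u t -> obs_active (tr t) a,
      ~ obs_active (tr (s - 1)) a
    & if u is Some n then ~ obs_active (tr (n + 1)) a else True].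

(* [buf a t] is the buffer of [a] at time [t], arrivals at [t] included;
   what [a] consumes, reroutes or discards at [t] is gone at [t + 1].
   [pol o t] is the policy of [o] after its possible update at time [t]. *)
Record execution (S : system) (buf : Agent -> int -> set occurrence)
    (pol : occurrence -> int -> Policy) (tr : trace) : Prop := {
  exec_past : forall t, t < 0 -> quiet (tr t) /\ forall a, buf a t = set0;
  exec_start :
    obs_event (tr 0) = Some (Initial (init_event S) (init_agents S)) /\
    pol (init_event S, 0) 0 = update S (init_event S).2 0;
  exec_start_uniq : forall t e R,
    obs_event (tr t) = Some (Initial e R) -> t = 0;
  exec_agents : forall t, obs_active (tr t) `<=` agents S;
  exec_activate : forall a t, agents S a ->
    ~ obs_active (tr (t - 1)) a -> buf a t <> buf a (t - 1) ->
    obs_active (tr t) a;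
  exec_buffer : forall a t,
    buf a (t + 1) =
      (buf a t `\` [set o | exists2 l, obs_treat (tr t) a o = Some l & l <> Delay])
      `|` [set o | delivered tr o a (t + 1)];
  exec_treat : forall a o l t, obs_treat (tr t) a o = Some l ->
    [/\ obs_active (tr t) a, buf a t o & l = Consume -> inputs S a o.1];
  (* the input may have been processed earlier in the same activation *)
  exec_generate : forall a e l t, obs_event (tr t) = Some (Generated a e l) ->
    obs_active (tr t) a /\
    (exists s u x r, [/\ activation tr a s u, within s u t, within s u r, r <= t
                       & [/\ buf a r x, inputs S a x.1 & transform S a x.1 e]]) /\
    pol (e, t) t = e.2;
  exec_deliver : forall o R t, obs_event (tr t) = Some (Delivered o R) ->
    [/\ emitted tr o, o.2 < t, ~ empty_policy S (pol o (t - 1)),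
        R = recipients S (pol o (t - 1)) t
      & pol o t = update S (pol o (t - 1)) t];
  exec_policy : forall o t, emitted tr o -> o.2 < t ->
    (forall R, obs_event (tr t) <> Some (Delivered o R)) ->
    pol o t = pol o (t - 1);
  (* logical time advances only when an interaction occurs *)
  exec_advance : forall s t, 0 <= s -> s <= t -> quiet (tr s) -> quiet (tr t);
  exec_terminate : forall a e l s t,
    obs_event (tr s) = Some (Generated a e l) -> terminal S e -> s < t ->
    quiet (tr t)
}.

Definition observable (S : system) (tr : trace) : Prop :=
  exists buf pol, execution S buf pol tr.

Definition trace_space (C : set system) : Type :=
  {tr : trace | exists2 S, C S & observable S tr}.

Record act_node := ActNode {
  act_id : (Agent * int)%type;
  act_agent : Agent;
  act_start : int;
  act_end : option int
}.

(* [ev_recv] is the graph of the recipient-indexed family of delivery times. *)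
Record ev_node := EvNode {
  ev_event : event;
  ev_gen : int;
  ev_recv : set (Agent * int)
}.

Inductive edge :=
| GenEdge of act_node & ev_node
| DelEdge of ev_node & act_node.

Definition edge_on (A : set act_node) (E : set ev_node) (x : edge) : Prop :=
  match x with
  | GenEdge v e => A v /\ E e
  | DelEdge e v => E e /\ A v
  end.

Record dig := Dig {
  dig_act : set act_node;
  dig_ev : set ev_node;
  dig_edge : set edge;
  dig_edge_on : dig_edge `<=` edge_on dig_act dig_ev;
  dig_label : {x : edge | dig_edge x} -> label
}.

Definition dig_seq := int -> dig.

Definition edge_map (fA : act_node -> act_node) (fE : ev_node -> ev_node)
    (x : edge) : edge :=
  match x with
  | GenEdge v e => GenEdge (fA v) (fE e)
  | DelEdge e v => DelEdge (fE e) (fA v)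
  end.

(* One pair of node bijections serves all times; the data carried by the nodes
   (agents, events, times) need not be preserved. *)
Definition dig_iso (G H : dig_seq) : Prop :=
  exists (fA : act_node -> act_node) (fE : ev_node -> ev_node),
    [/\ set_bij (\bigcup_t dig_act (G t)) (\bigcup_t dig_act (H t)) fA,
        set_bij (\bigcup_t dig_ev (G t)) (\bigcup_t dig_ev (H t)) fE
      & forall t,
        [/\ fA @` dig_act (G t) = dig_act (H t),
            fE @` dig_ev (G t) = dig_ev (H t),
            forall x, edge_on (dig_act (G t)) (dig_ev (G t)) x ->
              (dig_edge (G t) x <-> dig_edge (H t) (edge_map fA fE x))
          & forall x (Gx : dig_edge (G t) x)
                (Hx : dig_edge (H t) (edge_map fA fE x)),
              dig_label (exist _ x Gx) = dig_label (exist _ _ Hx)]].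

(* The graph at time [t] is cumulative: it has the activations started and the
   events generated by time [t]. *)
Definition trace_act (tr : trace) (t : int) : set act_node :=
  [set v | [/\ act_id v = (act_agent v, act_start v),
               activation tr (act_agent v) (act_start v) (act_end v)
             & act_start v <= t]].

Definition node_of_occurrence (tr : trace) (o : occurrence) : ev_node :=
  EvNode o.1 o.2 [set bt | delivered tr o bt.1 bt.2].

Definition trace_ev (tr : trace) (t : int) : set ev_node :=
  node_of_occurrence tr @` [set o | emitted tr o /\ o.2 <= t].

Definition ev_occ (e : ev_node) : occurrence := (ev_event e, ev_gen e).

(* [l] is the latest treatment of [o] by the activation [v] up to time [t]. *)
Definition treatment (tr : trace) (o : occurrence) (v : act_node) (t : int)
    (l : label) : Prop :=
  exists s,
    [/\ within (act_start v) (act_end v) s, s <= t,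
        obs_treat (tr s) (act_agent v) o = Some l
      & forall r, s < r -> r <= t -> within (act_start v) (act_end v) r ->
          obs_treat (tr r) (act_agent v) o = None].

(* An event triggers the activation which its delivery starts, and also any
   later activation that treats it, for instance after a delay. *)
Definition triggers (tr : trace) (o : occurrence) (v : act_node) (t : int) : Prop :=
  delivered tr o (act_agent v) (act_start v) \/ exists l, treatment tr o v t l.

Definition generates (tr : trace) (v : act_node) (o : occurrence) : Prop :=
  within (act_start v) (act_end v) o.2 /\
  exists l, obs_event (tr o.2) = Some (Generated (act_agent v) o.1 l).

Definition trace_edge (tr : trace) (t : int) : set edge :=
  edge_on (trace_act tr t) (trace_ev tr t) `&`
  [set x | match x with
           | GenEdge v e => generates tr v (ev_occ e)
           | DelEdge e v => triggers tr (ev_occ e) v t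
           end].

(* A triggering event not treated so far is still in the buffer, whence the
   default [Delay]; the other default is never used on an edge. *)
Definition trace_label (tr : trace) (t : int) (x : edge) : label :=
  match x with
  | GenEdge v e =>
      if obs_event (tr (ev_gen e)) is Some (Generated _ _ l) then l else Consume
  | DelEdge e v => xget Delay [set l | treatment tr (ev_occ e) v t l]
  end.

Definition Psi (tr : trace) : dig_seq := fun t =>
  @Dig (trace_act tr t) (trace_ev tr t) (trace_edge tr t)
    (@subIsetl _ _ _) (fun x => trace_label tr t (sval x)).

End Definitions.

(* Main.v *)
(* Choose for every DIG sequence [G] in the range of [Psi] a trace it comes from, and
   let [I G] be the value of [Phi] there; isomorphism being reflexive, invariance
   makes this value independent of the choice. *)
Require Import Defs.
From mathcomp Require Import all_boot all_order all_algebra.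
From mathcomp Require Import boolp classical_sets functions cardinality.

Lemma edge_map_id (Agent Payload Policy : Type) (x : edge Agent Payload Policy) :
  edge_map id id x = x.
Proof. by case: x. Qed.

Lemma set_bij_id (T : Type) (A : set T) : set_bij A A id.
Proof. by split=> [//|x y _ _ //|x Ax]; exists x. Qed.

Lemma dig_iso_refl (Agent Payload Policy : Type)
    (G : dig_seq Agent Payload Policy) : dig_iso G G.
Proof.
exists id, id; split; [exact: set_bij_id | exact: set_bij_id | move=> t].
split; [exact: image_id | exact: image_id | by move=> x _; rewrite edge_map_id | ].
move=> x; rewrite edge_map_id => Gx Hx.
(* Labels live on a sigma type, so the two proofs that [x] is an edge must be identified. *)
by rewrite (Prop_irrelevance Gx Hx).
Qed.

Theorem theorem1 (Agent Payload Policy : Type)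
    (C : set (system Agent Payload Policy))
    (F : Type) (F_nonempty : inhabited F)
    (Phi : trace_space C -> F)
    (Phi_invariant : forall T1 T2 : trace_space C,
       dig_iso (Psi (sval T1)) (Psi (sval T2)) -> Phi T1 = Phi T2) :
  exists I : dig_seq Agent Payload Policy -> F,
    forall T : trace_space C, Phi T = I (Psi (sval T)).
Proof.
(* [f0] serves as value outside the range of [Psi]: [I] is total and DIG sequences exist even if [C]
   has no traces. *)
have [f0] := F_nonempty.
(* Quantifying over all [T] above [G] makes the condition vacuous off the range, so [choice] applies
   to every [G]. *)
have value G : exists y, forall T : trace_space C, Psi (sval T) = G -> Phi T = y.
  have [[T0 <-]|noT] := pselect (exists T : trace_space C, Psi (sval T) = G).
    exists (Phi T0) => T eqT; apply: Phi_invariant.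
    by rewrite eqT; apply: dig_iso_refl.
  by exists f0 => T eqT; case: noT; exists T.
have [I IP] := choice value.
by exists I => T; apply: IP.
Qed.
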